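(* Let $G$ be a connected graph on $n$ vertices with resistance deviations $\delta_1,\dots,\delta_n$ and resistance deviation operator $T$. For every $x\in\mathbb R^n$, \[ x^\top Tx=\sum_{i=1}^n\delta_i x_i^2-\frac2n\Bigl(\sum_{i=1}^n\delta_i x_i\Bigr)\Bigl(\sum_{i=1}^n x_i\Bigr). \] In particular, if $x\perp\mathbf 1$, then $x^\top Tx=\sum_{i=1}^n\delta_i x_i^2$.
   Context: $G=(V,E)$ is a finite, simple, connected, undirected, unweighted graph with vertex set $V=\{1,\dots,n\}$. $L=D_G-A$ is its combinatorial Laplacian (degree matrix minus adjacency matrix). $\mathbf 1\in\mathbb R^n$ is the all-ones vector, $I$ the identity matrix, $J=\mathbf 1\mathbf 1^\top$, $P=I-\frac1n J$. $L^\dagger$ is the Moore--Penrose inverse of $L$, i.e. the unique symmetric matrix with $LL^\dagger=L^\dagger L=I-\frac1n\mathbf 1\mathbf 1^\top$ and $L^\dagger\mathbf 1=\mathbf 0$. Put $d_i=(L^\dagger)_{ii}$, $D=\operatorname{diag}(d_1,\dots,d_n)$, $\bar d=\frac1n\operatorname{tr}(L^\dagger)$, and $\Delta=D-\bar d I$, whose diagonal entries $\delta_1,\dots,\delta_n$ are the resistance deviations. The resistance deviation operator is the matrix $T=\Delta P+P\Delta-\Delta$. *)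

(* Defs.v *)
From mathcomp Require Import all_boot all_order all_algebra.

Set Implicit Arguments.
Unset Strict Implicit.
Unset Printing Implicit Defensive.

Import Order.TTheory GRing.Theory Num.Theory.
Local Open Scope ring_scope.

Record simple_graph (n : nat) := SimpleGraph {
  adj : rel 'I_n;
  adj_sym : symmetric adj;
  adj_irr : irreflexive adj }.

Definition connected_graph n (G : simple_graph n) : Prop :=
  (0 < n)%N /\ forall i j, connect (adj G) i j.

Section PseudoInverse.
Variable R : realFieldType.

(* The four Penrose conditions; over a real field the transpose is the
   conjugate transpose. *)
Definition is_mpinv m n (A : 'M[R]_(m, n)) (M : 'M[R]_(n, m)) : bool :=
  [&& A *m M *m A == A, M *m A *m M == M,
      (A *m M)^T == A *m M & (M *m A)^T == M *m A].

Lemma mulmx_trmx_unit r n (F : 'M[R]_(r, n)) :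
  row_free F -> F *m F^T \in unitmx.
Proof.
move=> freeF; rewrite -row_free_unit; apply: inj_row_free => u uFF0.
suff uF0 : u *m F = 0 by apply: (row_free_inj freeF); rewrite uF0 mul0mx.
have : ((u *m F) *m (u *m F)^T) 0 0 = 0.
  by rewrite trmx_mul mulmxA -(mulmxA u) uFF0 mul0mx mxE.
rewrite mxE; under eq_bigr do rewrite [_^T _ _]mxE -expr2.
move=> /eqP; rewrite psumr_eq0 => [/allP w0|j _]; last exact: sqr_ge0.
apply/rowP=> j; rewrite [RHS]mxE; apply/eqP.
by have := w0 j (mem_index_enum _); rewrite /= sqrf_eq0.
Qed.

Lemma is_mpinv_exists m n (A : 'M[R]_(m, n)) : exists M, is_mpinv A M.
Proof.
set C := col_base A; set F := row_base A.
have AE : A = C *m F by rewrite mulmx_base.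
have uF : F *m F^T \in unitmx by apply: mulmx_trmx_unit; exact: row_base_free.
have uC : C^T *m C \in unitmx.
  rewrite -{2}[C]trmxK; apply: mulmx_trmx_unit.
  by rewrite /row_free mxrank_tr; exact: col_base_full.
clearbody C F; move: (\rank A) C F AE uF uC => r C F AE uF uC.
pose F' := F^T *m invmx (F *m F^T); pose C' := invmx (C^T *m C) *m C^T.
have FF' : F *m F' = 1%:M by rewrite mulmxA mulmxV.
have C'C : C' *m C = 1%:M by rewrite -mulmxA mulVmx.
have sCC' : (C *m C')^T = C *m C'.
  by rewrite /C' !trmx_mul trmxK trmx_inv trmx_mul trmxK mulmxA.
have sF'F : (F' *m F)^T = F' *m F.
  by rewrite /F' !trmx_mul trmxK trmx_inv trmx_mul trmxK mulmxA.
clearbody F' C'.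
have AM : A *m (F' *m C') = C *m C'.
  by rewrite AE -!mulmxA (mulmxA F) FF' mul1mx.
have MA : F' *m C' *m A = F' *m F.
  by rewrite AE -!mulmxA (mulmxA C') C'C mul1mx.
exists (F' *m C'); apply/and4P; split; apply/eqP; rewrite ?AM ?MA //.
  by rewrite {1}AE mulmxA -(mulmxA C) C'C mulmx1 -AE.
by rewrite mulmxA -(mulmxA F') FF' mulmx1.
Qed.

Definition mpinv m n (A : 'M[R]_(m, n)) : 'M[R]_(n, m) :=
  xchoose (is_mpinv_exists A).

Lemma is_mpinv_uniq m n (A : 'M[R]_(m, n)) (M N : 'M[R]_(n, m)) :
  is_mpinv A M -> is_mpinv A N -> M = N.
Proof.
case/and4P=> /eqP AMA /eqP MAM /eqP sAM /eqP sMA.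
case/and4P=> /eqP ANA /eqP NAN /eqP sAN /eqP sNA.
have eAM : A *m M = A *m N.
  by rewrite -[LHS]sAM -{1}ANA -(mulmxA _ A M) trmx_mul sAM sAN mulmxA AMA.
have eMA : M *m A = N *m A.
  rewrite -[LHS]sMA -{1}ANA -(mulmxA A N A) mulmxA trmx_mul sNA sMA.
  by rewrite -mulmxA (mulmxA A M A) AMA.
by rewrite -MAM eMA -mulmxA eAM mulmxA NAN.
Qed.

Lemma mpinvE m n (A : 'M[R]_(m, n)) (M : 'M[R]_(n, m)) :
  is_mpinv A M -> mpinv A = M.
Proof. by move=> AM; apply: is_mpinv_uniq AM; exact: xchooseP. Qed.

End PseudoInverse.

Section Matrices.
Variables (R : realFieldType) (n : nat) (G : simple_graph n).

Definition adjmx : 'M[R]_n := \matrix_(i, j) (adj G i j)%:R.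

Definition degree (i : 'I_n) : nat := #|[set j | adj G i j]|.

Definition degmx : 'M[R]_n := diag_mx (\row_i (degree i)%:R).

Definition laplacian : 'M[R]_n := degmx - adjmx.

Definition ones : 'cV[R]_n := const_mx 1.

Definition Jmx : 'M[R]_n := ones *m ones^T.

Definition Pmx : 'M[R]_n := 1%:M - n%:R^-1 *: Jmx.

Definition Ldag : 'M[R]_n := mpinv laplacian.

Definition Dmx : 'M[R]_n := diag_mx (\row_i Ldag i i).

Definition dbar : R := n%:R^-1 * \tr Ldag.

Definition Deltamx : 'M[R]_n := Dmx - dbar%:M.

Definition delta (i : 'I_n) : R := Deltamx i i.

Definition Tmx : 'M[R]_n := Deltamx *m Pmx + Pmx *m Deltamx - Deltamx.

Lemma laplacian_sym : laplacian^T = laplacian.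
Proof.
rewrite /laplacian linearB /= tr_diag_mx; congr (_ - _).
by apply/matrixP=> i j; rewrite !mxE adj_sym.
Qed.

Lemma laplacianE (v : 'cV[R]_n) i :
  (laplacian *m v) i 0 = \sum_j (adj G i j)%:R * (v i 0 - v j 0).
Proof.
rewrite mulmxBl !mxE (bigD1 i) //= big1 => [|j ji]; last first.
  by rewrite !mxE eq_sym (negPf ji) mulr0n mul0r.
rewrite !mxE eqxx mulr1n addr0.
under [RHS]eq_bigr do rewrite mulrBr.
rewrite sumrB -mulr_suml; congr (_ * _ - _); last first.
  by apply: eq_bigr => j _; rewrite mxE.
by rewrite -natr_sum /degree -sum1dep_card big_mkcond.
Qed.

Lemma laplacian_ones : laplacian *m ones = 0.
Proof.
apply/colP=> i; rewrite laplacianE !mxE big1 // => j _.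
by rewrite !mxE subrr mulr0.
Qed.

Lemma laplacian_ker (v : 'cV[R]_n) : connected_graph G ->
  laplacian *m v = 0 -> forall i j, v i 0 = v j 0.
Proof.
case=> n_gt0 cG Lv0.
pose k := [arg max_(i > Ordinal n_gt0) v i 0]%O.
have vmax i : v i 0 <= v k 0.
  by rewrite /k; case: Order.TotalTheory.arg_maxP => // l _; apply.
suff vk : forall i, v i 0 = v k 0 by move=> i j; rewrite !vk.
have cl : closed (adj G) [pred i | v i 0 == v k 0].
  apply: intro_closed; first by by apply: sym_connect_sym; exact: adj_sym.
  move=> i j ij; rewrite !inE => /eqP vi.
  have /eqP := congr1 (fun w : 'cV_n => w i 0) Lv0.
  rewrite laplacianE mxE psumr_eq0 => [/allP /(_ j (mem_index_enum _)) /=|l _].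
    by rewrite ij mul1r subr_eq0 vi eq_sym.
  by rewrite mulr_ge0 ?ler0n // subr_ge0 vi vmax.
by move=> i; have := closed_connect cl (cG k i); rewrite !inE eqxx => /esym/eqP.
Qed.

(* The Moore-Penrose inverse of the Laplacian of a connected graph exists, and
   is the unique symmetric matrix inverting it on the complement of [ones] and
   killing [ones]. *)
Lemma laplacian_mpinvP (M : 'M[R]_n) : connected_graph G ->
  M = Ldag <->
  [/\ M^T = M, laplacian *m M = Pmx, M *m laplacian = Pmx & M *m ones = 0].
Proof.
move=> cG; have n_neq0 : n%:R != 0 :> R by rewrite pnatr_eq0 -lt0n; case: cG.
pose Q : 'M[R]_n := n%:R^-1 *: Jmx; pose L := laplacian.
have o1 : ones^T *m ones = n%:R%:M.
  apply/matrixP=> i j; rewrite !ord1 !mxE eqxx mulr1n.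
  under eq_bigr do rewrite !mxE mulr1.
  by rewrite sumr_const card_ord.
have Qo : Q *m ones = ones.
  by rewrite -scalemxAl -mulmxA o1 mul_mx_scalar scalerA mulVf ?scale1r.
have sQ : Q^T = Q by rewrite linearZ /= trmx_mul trmxK.
have mulQ (A : 'M[R]_n) : A *m Q = n%:R^-1 *: (A *m ones *m ones^T).
  by rewrite -scalemxAr mulmxA.
have QQ : Q *m Q = Q by rewrite mulQ Qo.
have LQ : L *m Q = 0 by rewrite mulQ laplacian_ones mul0mx scaler0.
have sL : L^T = L := laplacian_sym.
have QL : Q *m L = 0 by rewrite -[LHS]trmxK trmx_mul sL sQ LQ trmx0.
have pinvP N : [/\ N^T = N, L *m N = Pmx, N *m L = Pmx & N *m ones = 0] ->
    is_mpinv L N.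
  case=> sN LN NL No; have sP : Pmx^T = Pmx by rewrite linearB /= sQ trmx1.
  have QN : Q *m N = 0.
    by rewrite -[LHS]trmxK trmx_mul sN sQ mulQ No mul0mx scaler0 trmx0.
  by rewrite /is_mpinv LN NL sP !mulmxBl !mul1mx -/Q QL QN !subr0 !eqxx.
suff [N PN] : exists N,
    [/\ N^T = N, L *m N = Pmx, N *m L = Pmx & N *m ones = 0].
  rewrite /Ldag (mpinvE (pinvP _ PN)); split=> [-> //|/pinvP LM].
  exact: is_mpinv_uniq LM (pinvP _ PN).
pose B := L + Q; have uB : B \in unitmx.
  rewrite -row_free_unit; apply: inj_row_free => u uB0.
  have uQ0 : u *m Q = 0.
    have : u *m B *m Q = 0 by rewrite uB0 mul0mx.
    by rewrite -mulmxA mulmxDl LQ QQ add0r.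
  have Lu : L *m u^T = 0.
    by rewrite -sL -trmx_mul -[u *m L]addr0 -{1}uQ0 -mulmxDr uB0 trmx0.
  have Qu : Q *m u^T = 0 by rewrite -sQ -trmx_mul uQ0 trmx0.
  apply/trmx_inj; rewrite trmx0; apply/colP=> i.
  have uc : u^T = u^T i 0 *: ones.
    by apply/colP=> j; rewrite [RHS]mxE [ones _ _]mxE mulr1 (laplacian_ker cG Lu j i).
  move: Qu; rewrite uc -scalemxAr Qo => /colP/(_ i).
  by rewrite !mxE !mulr1.
have sB : B^T = B by rewrite linearD /= sL sQ.
have BQ : B *m Q = Q by rewrite mulmxDl LQ QQ add0r.
have VQ : invmx B *m Q = Q by rewrite -{1}BQ mulKmx.
have sV : (invmx B)^T = invmx B by rewrite trmx_inv sB.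
have sN : (invmx B - Q)^T = invmx B - Q by rewrite linearB /= sV sQ.
have NL : (invmx B - Q) *m L = Pmx.
  have {1}-> : L = B - Q by rewrite /B addrK.
  rewrite mulmxBr !mulmxBl VQ QQ subrr subr0 mulVmx //.
  by rewrite mulmxDr QL QQ add0r.
exists (invmx B - Q); split=> //.
  by rewrite -[LHS]trmxK trmx_mul sL sN NL linearB /= sQ trmx1.
rewrite mulmxBl -{1}Qo mulmxA VQ Qo; exact: subrr.
Qed.

End Matrices.

(* Main.v *)
Require Import Defs.
From mathcomp Require Import all_boot all_order all_algebra.
From mathcomp Require Import ring.

(** Write [Delta] for the diagonal matrix of the deviations [delta i].  Since
    [P = I - J / n], one of the two copies of [Delta] coming from the products
    with [P] cancels the subtracted one, leaving
    [T = Delta - (Delta J + J Delta) / n] ([Tmx_Delta_Jmx]).  As [Delta] is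
    symmetric, the correction is made of the values of the bilinear form of
    [J] at [x] and [Delta x], in both orders; as [J = 1 1^T] has rank one,
    each of them factors as [(sum_i delta_i x_i) (sum_i x_i)] ([Jmx_form]).
    The second factor is the inner product of [x] and [1], so the correction
    vanishes when [x] is orthogonal to [1]. *)

Import Order.TTheory GRing.Theory Num.Theory.
Local Open Scope ring_scope.

Lemma diag_mx_form (R : comNzRingType) (n : nat) (d : 'rV[R]_n)
    (x y : 'cV[R]_n) :
  (x^T *m diag_mx d *m y) 0 0 = \sum_i d 0 i * x i 0 * y i 0.
Proof.
rewrite mul_mx_diag mxE; apply: eq_bigr => i _.
by rewrite !mxE [d 0 i * _]mulrC.
Qed.

Lemma tr_mul_ones (R : realFieldType) (n : nat) (x : 'cV[R]_n) :
  (x^T *m ones R n) 0 0 = \sum_i x i 0.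
Proof. by rewrite mxE; apply: eq_bigr => i _; rewrite !mxE mulr1. Qed.

(** Since [J = 1 1^T] has rank one, the form passes through the scalars
    [x^T 1] and [1^T y]. *)
Lemma Jmx_form (R : realFieldType) (n : nat) (x y : 'cV[R]_n) :
  (x^T *m Jmx R n *m y) 0 0 = (\sum_i x i 0) * (\sum_i y i 0).
Proof.
have -> : x^T *m Jmx R n *m y = x^T *m ones R n *m (y^T *m ones R n)^T.
  by rewrite trmx_mul trmxK /Jmx !mulmxA.
by rewrite mxE big_ord1 [_^T 0 0]mxE !tr_mul_ones.
Qed.

Section Deviation.
Variables (R : realFieldType) (n : nat) (G : simple_graph n).

Lemma Deltamx_diag : Deltamx R G = diag_mx (\row_i delta R G i).
Proof.
apply/matrixP=> i j; have [->|ij] := eqVneq i j.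
  by rewrite [RHS]mxE eqxx mulr1n [RHS]mxE.
by rewrite !mxE (negPf ij) !mulr0n subr0.
Qed.

Lemma Deltamx_mul (x : 'cV[R]_n) i :
  (Deltamx R G *m x) i 0 = delta R G i * x i 0.
Proof. by rewrite Deltamx_diag mul_diag_mx !mxE. Qed.

Lemma Deltamx_sym : (Deltamx R G)^T = Deltamx R G.
Proof. by rewrite Deltamx_diag tr_diag_mx. Qed.

Lemma Deltamx_form (x : 'cV[R]_n) :
  (x^T *m Deltamx R G *m x) 0 0 = \sum_i delta R G i * x i 0 ^+ 2.
Proof.
rewrite Deltamx_diag diag_mx_form.
by apply: eq_bigr => i _; rewrite mxE expr2 mulrA.
Qed.

Lemma Tmx_Delta_Jmx :
  Tmx R G =
    Deltamx R G - n%:R^-1 *: (Deltamx R G *m Jmx R n + Jmx R n *m Deltamx R G).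
Proof.
rewrite /Tmx /Pmx; move: (Deltamx R G) (Jmx R n) => D J.
rewrite mulmxBr mulmxBl mulmx1 mul1mx -scalemxAr -scalemxAl scalerDr.
by rewrite addrACA -opprD addrAC addrK.
Qed.

Lemma Tmx_form (x : 'cV[R]_n) :
  (x^T *m Tmx R G *m x) 0 0 =
    \sum_i delta R G i * x i 0 ^+ 2
    - 2 / n%:R * (\sum_i delta R G i * x i 0) * (\sum_i x i 0).
Proof.
pose y := Deltamx R G *m x.
have sum_y : \sum_i y i 0 = \sum_i delta R G i * x i 0.
  by apply: eq_bigr => i _; rewrite Deltamx_mul.
(* By symmetry of Delta, both mixed products are J-forms in x and Delta x. *)
have -> : x^T *m Tmx R G *m x =
    x^T *m Deltamx R G *m x
    - n%:R^-1 *: (y^T *m Jmx R n *m x + x^T *m Jmx R n *m y).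
  rewrite Tmx_Delta_Jmx /y trmx_mul Deltamx_sym.
  move: (Deltamx R G) (Jmx R n) => D J.
  rewrite mulmxBr mulmxBl -scalemxAr -scalemxAl mulmxDr mulmxDl.
  by rewrite !mulmxA.
have entry (A B C : 'M[R]_1) (c : R) :
  (A - c *: (B + C)) 0 0 = A 0 0 - c * (B 0 0 + C 0 0) by rewrite !mxE.
by rewrite entry Deltamx_form !Jmx_form sum_y; ring.
Qed.

End Deviation.

Theorem proposition2p10 (R : realFieldType) (n : nat) (G : simple_graph n)
    (hG : connected_graph G) (x : 'cV[R]_n) :
  (x^T *m Tmx R G *m x) 0 0 =
    \sum_i delta R G i * x i 0 ^+ 2
    - 2 / n%:R * (\sum_i delta R G i * x i 0) * (\sum_i x i 0)
  /\ ((x^T *m ones R n) 0 0 = 0 ->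
      (x^T *m Tmx R G *m x) 0 0 = \sum_i delta R G i * x i 0 ^+ 2).
Proof.
split; first exact: Tmx_form.
by rewrite tr_mul_ones Tmx_form => ->; rewrite mulr0 subr0.
Qed.
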